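(* Let $\kappa>0$, $D_\kappa=\pi/\sqrt{\kappa}$, let $X$ be a CAT$(\kappa)$ space, $C\subseteq X$ a bounded convex subset, $T:C\to C$ a nonexpansive mapping, and let $0<M<\frac{D_\kappa}{2}$ be an upper bound on the (finite) diameter of $C$. Let $(\lambda_n)_{n\ge 1}$ be a sequence in $[0,1]$ and let $\alpha:(0,\infty)\to\mathbb{Z}_+$, $\gamma:(0,\infty)\to\mathbb{Z}_+$, $\theta:\mathbb{Z}_+\to\mathbb{Z}_+$ satisfy condition ( * ) given in the context. Let $u\in C$ and let $(x_n)_{n\ge 0}$ be the Halpern iteration $x_0=u$, $x_{n+1}=\lambda_{n+1}u+(1-\lambda_{n+1})Tx_n$. Then $\lim_{n\to\infty}d(x_n,x_{n+1})=0$ with rate of convergence $\tilde\Phi$ given by $$\tilde{\Phi}(\varepsilon,\kappa,M,\gamma,\theta)=\theta\left(\left\lceil\frac1{\cos(M \sqrt{\kappa})}\right\rceil\left(\gamma\left(\frac{\varepsilon}{2M}\right)+\max\left\{\left\lceil\ln\left(\frac{2M}{\varepsilon}\right)\right\rceil,1\right\}\right)\right),$$ and $\lim_{n\to\infty}d(x_n,Tx_n)=0$ with rate of convergence $\Phi$ given by $$\Phi(\varepsilon,\kappa,M,\gamma,\theta,\alpha)=\max\left\{\tilde{\Phi}\left(\frac{\varepsilon}{2},\kappa,M,\gamma,\theta\right),\ \alpha\left(\frac{\varepsilon}{2M}\right)\right\}.$$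
   Context: $\mathbb{Z}_+=\{1,2,\ldots\}$. For points $x,y$ of a CAT$(\kappa)$ space with $d(x,y)<D_\kappa$ and $t\in[0,1]$, $(1-t)x+ty$ denotes the unique point $z$ of the geodesic segment $[x,y]$ with $d(z,x)=t\,d(x,y)$ and $d(z,y)=(1-t)d(x,y)$. A set is convex if it contains any geodesic segment joining two of its points. $T$ is nonexpansive if $d(Tx,Ty)\le d(x,y)$ for all $x,y$. A function $\Phi:(0,\infty)\to\mathbb{Z}_+$ is a rate of convergence of a nonnegative sequence $(a_n)$ towards $0$ if $a_n\le\varepsilon$ for all $\varepsilon>0$ and all $n\ge\Phi(\varepsilon)$. Condition ( * ) on $(\lambda_n),\alpha,\gamma,\theta$: (1) $\lambda_{n+1}\le\varepsilon$ for all $\varepsilon>0$ and all $n\ge\alpha(\varepsilon)$; (2) $\sum_{i=\gamma(\varepsilon)+1}^{\gamma(\varepsilon)+n}|\lambda_{i+1}-\lambda_i|\le\varepsilon$ for all $\varepsilon>0$ and all $n\in\mathbb{Z}_+$; (3) $\sum_{k=1}^{\theta(n)}\lambda_{k+1}\ge n$ for all $n\in\mathbb{Z}_+$. *)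

(* Defs.v *)
From HB Require Import structures.
From mathcomp Require Import all_boot all_order all_algebra.
From mathcomp Require Import all_classical all_reals all_analysis.

Set Implicit Arguments.
Unset Strict Implicit.
Unset Printing Implicit Defensive.

Import Order.TTheory GRing.Theory Num.Theory.
Import numFieldNormedType.Exports.

Local Open Scope classical_set_scope.
Local Open Scope ring_scope.

(* Geodesics are defined for a bare distance function, so that the same
   definitions serve for metric spaces and for the model space M_kappa^2. *)
Section Geodesics.
Context {R : realType} {T : Type} (dist : T -> T -> R).

Definition geodesic_path (x y : T) (l : R) (c : R -> T) : Prop :=
  [/\ 0 <= l, c 0 = x, c l = y &
      forall s t : R, 0 <= s <= l -> 0 <= t <= l ->
        dist (c s) (c t) = `|s - t| ].

Definition geodesic_segment (x y : T) (S : set T) : Prop :=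
  exists (l : R) (c : R -> T), geodesic_path x y l c /\ S = c @` `[0, l].

(* Side i joins vertex i to the cyclically next vertex. *)
Definition geodesic_triangle (v : 'I_3 -> T) (side : 'I_3 -> set T) : Prop :=
  forall i, geodesic_segment (v i) (v (ordS i)) (side i).

Definition perimeter (v : 'I_3 -> T) : R := \sum_(i < 3) dist (v i) (v (ordS i)).

Definition convex (C : set T) : Prop :=
  forall x y S, C x -> C y -> geodesic_segment x y S -> S `<=` C.

(* z = (1 - t) x + t y *)
Definition geodesic_combination (t : R) (x y z : T) : Prop :=
  exists S, [/\ geodesic_segment x y S, S z,
    dist z x = t * dist x y & dist z y = (1 - t) * dist x y].

Definition diameter (C : set T) : \bar R :=
  ereal_sup [set (dist p.1 p.2)%:E | p in C `*` C].

Definition nonexpansive_on (C : set T) (f : T -> T) : Prop :=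
  forall x y, C x -> C y -> dist (f x) (f y) <= dist x y.

End Geodesics.

(* The model space M_kappa^2, kappa > 0: the unit sphere S^2 of R^3 with its
   angular metric divided by sqrt kappa. *)
Section ModelSpace.
Context {R : realType}.

Definition dotp (u v : 'rV[R]_3) : R := \sum_(i < 3) u 0 i * v 0 i.

Definition sphere2 : Type := {u : 'rV[R]_3 | dotp u u == 1}.

Definition model_dist (kappa : R) (u v : sphere2) : R :=
  acos (dotp (val u) (val v)) / Num.sqrt kappa.

(* The diameter D_kappa of M_kappa^2. *)
Definition model_diam (kappa : R) : R := pi / Num.sqrt kappa.

End ModelSpace.
Arguments sphere2 : clear implicits.

Section CAT.
Context {R : realType}.

Definition comparison_triangle (kappa : R) (X : metricType R)
    (v : 'I_3 -> X) (w : 'I_3 -> sphere2 R) (wside : 'I_3 -> set (sphere2 R)) :=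
  geodesic_triangle (model_dist kappa) w wside /\
  forall i, model_dist kappa (w i) (w (ordS i)) = mdist (v i) (v (ordS i)).

(* The comparison point of p in side i is the point q of the corresponding
   side of the comparison triangle at the same distance from vertex i. *)
Definition comparison_point (kappa : R) (X : metricType R)
    (v : 'I_3 -> X) (w : 'I_3 -> sphere2 R) (wside : 'I_3 -> set (sphere2 R))
    (i : 'I_3) (p : X) (q : sphere2 R) : Prop :=
  wside i q /\ model_dist kappa (w i) q = mdist (v i) p.

Definition CAT_inequality (kappa : R) (X : metricType R)
    (v : 'I_3 -> X) (side : 'I_3 -> set X) : Prop :=
  forall w wside, comparison_triangle kappa v w wside ->
  forall (i j : 'I_3) (p p' : X) (q q' : sphere2 R),
    side i p -> side j p' ->
    comparison_point kappa v w wside i p q ->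
    comparison_point kappa v w wside j p' q' ->
    mdist p p' <= model_dist kappa q q'.

(* CAT(kappa) for kappa > 0, in the sense of Bridson and Haefliger. *)
Definition CAT (kappa : R) (X : metricType R) : Prop :=
  (forall x y : X, mdist x y < model_diam kappa ->
     exists S, geodesic_segment mdist x y S) /\
  (forall (v : 'I_3 -> X) (side : 'I_3 -> set X),
     geodesic_triangle mdist v side ->
     perimeter mdist v < 2 * model_diam kappa ->
     CAT_inequality kappa v side).

End CAT.

Section Rates.
Context {R : realType}.

(* A function (0,oo) -> Z_+ is represented by a total function R -> nat, of
   which only the values at positive arguments matter. *)
Definition rate_of_convergence (Phi : R -> nat) (a : nat -> R) : Prop :=
  forall eps : R, 0 < eps ->
    (0 < Phi eps)%N /\ forall n, (Phi eps <= n)%N -> a n <= eps.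

Record condition_star (lam : nat -> R) (alpha gamma : R -> nat)
    (theta : nat -> nat) : Prop := {
  alpha_pos : forall eps : R, 0 < eps -> (0 < alpha eps)%N ;
  gamma_pos : forall eps : R, 0 < eps -> (0 < gamma eps)%N ;
  theta_pos : forall n, (0 < n)%N -> (0 < theta n)%N ;
  star1 : forall eps : R, 0 < eps ->
    forall n, (alpha eps <= n)%N -> lam n.+1 <= eps ;
  star2 : forall eps : R, 0 < eps -> forall n, (0 < n)%N ->
    \sum_(gamma eps + 1 <= i < (gamma eps + n).+1) `|lam i.+1 - lam i| <= eps ;
  star3 : forall n, (0 < n)%N ->
    n%:R <= \sum_(1 <= k < (theta n).+1) lam k.+1 }.

(* The ceilings are integers; they are positive where `|_|%N is applied
   (when 0 < M * sqrt kappa < pi / 2), so absz is just the cast to nat. *)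
Definition Phi_tilde (eps kappa M : R) (gamma : R -> nat) (theta : nat -> nat)
    : nat :=
  theta (`|Num.ceil (1 / cos (M * Num.sqrt kappa))| *
         (gamma (eps / (2 * M)) +
          `|Num.max (Num.ceil (ln (2 * M / eps))) 1|))%N.

Definition Phi_rate (eps kappa M : R) (gamma : R -> nat) (theta : nat -> nat)
    (alpha : R -> nat) : nat :=
  maxn (Phi_tilde (eps / 2) kappa M gamma theta) (alpha (eps / (2 * M))).

End Rates.

(* Main.v *)
Require Import Defs.
From HB Require Import structures.
From mathcomp Require Import all_boot all_order all_algebra.
From mathcomp Require Import all_classical all_reals all_analysis.
From mathcomp Require Import ring lra.

Set Implicit Arguments.
Unset Strict Implicit.
Unset Printing Implicit Defensive.

Import Order.TTheory GRing.Theory Num.Theory.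
Import numFieldNormedType.Exports.

Local Open Scope classical_set_scope.
Local Open Scope ring_scope.

(** Rescale to [kappa = 1] and write [m] for [M] and [k = 1 - l cos m]. Moving
    two points at distance at most [m < pi / 2] from [u] along geodesics towards
    [u], from distances [a], [b] to [(1 - l) a], [(1 - l) b], shrinks their
    distance by the factor [k]: by the CAT inequality this need only be checked
    on the sphere, where with [1 - cos x = 2 sin^2 (x / 2)] the spherical law of
    cosines reduces it to [sin ((1 - l) x) <= k sin x] for [0 <= x <= m], and
    [k sin (c / 2) <= sin (k c / 2)]. Hence
    [d (x_(n+1), x_(n+2)) <=
       (1 - lam_(n+2) cos m) d (x_n, x_(n+1)) + M |lam_(n+2) - lam_(n+1)|].
    From index [gamma (eps / 2M)] on, the added terms sum to at most [eps / 2],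
    while the product of the factors is at most the exponential of
    [- cos m * sum lam]. *)

(** * Trigonometric inequalities behind the contraction factor *)

Section Trigonometry.
Context {R : realType}.
Implicit Types a b c d k l m t x y : R.

Lemma le_cos x y : 0 <= x -> x <= y -> y <= pi -> cos y <= cos x.
Proof.
move=> x0 xy ypi; have ypos := le_trans x0 xy.
by rewrite leNgt ltr_cos ?in_itv/= ?x0 ?ypos ?ypi ?(le_trans xy ypi)// -leNgt.
Qed.

Lemma sin_sub_MVT x y : x <= y ->
  exists2 z, x <= z <= y & sin y - sin x = cos z * (y - x).
Proof.
move=> xy; have [z] := @MVT_segment R sin cos x y xy
  (fun u _ => is_derive_sin u) (continuous_subspaceT (@continuous_sin R)).
by rewrite in_itv/=; exists z.
Qed.

(* Concavity of [sin] on [[0, pi]]: the slope of [sin] over [[0, t a]] is at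
   least its slope over [[t a, a]]. *)
Lemma sin_mul_ge a t : 0 <= a <= pi -> 0 <= t <= 1 -> t * sin a <= sin (t * a).
Proof.
move=> /andP[a0 api] /andP[t0 t1].
have ta0 : 0 <= t * a by rewrite mulr_ge0.
have taa : t * a <= a by rewrite ler_piMl.
have [y /andP[y0 yta]] := sin_sub_MVT ta0; rewrite sin0 !subr0 => sin_ta.
have [z /andP[taz za] sin_a] := sin_sub_MVT taa.
have zy : cos z <= cos y.
  by rewrite le_cos ?(le_trans yta taz)// (le_trans za api).
(* By the two mean value forms, [sin (t * a) - t * sin a] equals this weight times
   [cos y - cos z]. *)
have w0 : 0 <= t * (1 - t) * a by rewrite !mulr_ge0// subr_ge0.
have := ler_wpM2l w0 zy; rewrite -subr_ge0 => h; rewrite -subr_ge0.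
have -> : sin (t * a) - t * sin a =
    (1 - t) * sin (t * a) - t * (sin a - sin (t * a)) by ring.
by rewrite sin_a sin_ta; apply: le_trans h _; rewrite le_eqVlt; apply/orP; left;
  apply/eqP; ring.
Qed.

(** Expand [sin (a - l * a)] and use [cos (l * a) <= 1], [l * sin a <= sin (l * a)] (concavity) and
    [cos m <= cos a]. *)
Lemma sin_1BM_le a m l : 0 <= a <= m -> m <= pi / 2 -> 0 <= l <= 1 ->
  sin ((1 - l) * a) <= (1 - l * cos m) * sin a.
Proof.
move=> /andP[a0 am] mpi lP; have /andP[l0 l1] := lP.
have pi0 := @pi_gt0 R.
have api : a <= pi by lra.
have sa : 0 <= sin a by rewrite sin_ge0_pi// a0.
have sla : l * sin a <= sin (l * a) by rewrite sin_mul_ge// a0.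
have cma : cos m <= cos a by apply: le_cos; lra.
have cm : 0 <= cos m by apply: cos_ge0_pihalf; lra.
have -> : (1 - l) * a = a - l * a by ring.
rewrite sinB.
have h1 : sin a * cos (l * a) <= sin a by rewrite ler_piMr// cos_le1.
have h2 : cos m * (l * sin a) <= cos a * sin (l * a).
  by rewrite ler_pM// mulr_ge0.
lra.
Qed.

Lemma cos_half x : cos x = 1 - 2 * sin (x / 2) ^+ 2.
Proof.
have {1}-> : x = (x / 2) *+ 2 by rewrite -mulr_natr; field.
by rewrite cos_mulr2n cos2sin2; ring.
Qed.

(** By the half-angle formula a linear bound on sines of half-angles squares to a bound on
    [1 - cos]. *)
Lemma le_1Bcos x y k : 0 <= sin (y / 2) -> sin (y / 2) <= k * sin (x / 2) ->
  1 - cos y <= k ^+ 2 * (1 - cos x).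
Proof.
move=> s0 sk; rewrite (cos_half x) (cos_half y).
have : sin (y / 2) ^+ 2 <= (k * sin (x / 2)) ^+ 2.
  by rewrite ler_pXn2r// nnegrE// (le_trans s0 sk).
rewrite exprMn; lra.
Qed.

(* Contraction of the sphere towards the vertex at which the sides [a] and [b]
   of a triangle meet: [D] is the cosine of the distance of the points of these
   sides at distances [(1 - l) a] and [(1 - l) b] from the vertex, given by the
   spherical law of cosines with the angle eliminated. *)
Lemma spherical_contraction a b c m l D : m <= pi / 2 ->
  0 < a <= m -> 0 < b <= m -> c <= m -> `|a - b| <= c -> 0 <= l <= 1 ->
  sin a * sin b * D = sin a * sin b * (cos ((1 - l) * a) * cos ((1 - l) * b)) +
    sin ((1 - l) * a) * sin ((1 - l) * b) * (cos c - cos a * cos b) ->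
  cos ((1 - l * cos m) * c) <= D.
Proof.
move=> mpi /andP[a0 am] /andP[b0 bm] cm abc lP eqD.
have /andP[l0 l1] := lP; have pi0 := @pi_gt0 R.
set t := 1 - l; set k := 1 - l * cos m.
have c0 : 0 <= c := le_trans (normr_ge0 _) abc.
have cosm0 : 0 <= cos m by apply: cos_ge0_pihalf; lra.
have lcos1 : l * cos m <= 1 by rewrite mulr_ile1// cos_le1.
have lcos0 : 0 <= l * cos m by rewrite mulr_ge0.
have k0 : 0 <= k by rewrite /k; lra.
have k1 : k <= 1 by rewrite /k; lra.
have t0 : 0 <= t by rewrite /t; lra.
have t1 : t <= 1 by rewrite /t; lra.
have sa : 0 < sin a by apply: sin_gt0_pi; lra.
have sb : 0 < sin b by apply: sin_gt0_pi; lra.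
(* Used at [a], at [b] and at half of [|a - b|]. *)
have shrink x : 0 <= x <= m -> 0 <= sin (t * x) <= k * sin x.
  move=> /andP[x0 xm]; apply/andP; split; last by apply: sin_1BM_le; rewrite ?x0.
  have tx : t * x <= x by rewrite ler_piMl.
  by apply: sin_ge0_pi; rewrite mulr_ge0//=; lra.
have /shrink/andP[sta0 sta] : 0 <= a <= m by rewrite ltW.
have /shrink/andP[stb0 stb] : 0 <= b <= m by rewrite ltW.
have stab : sin (t * a) * sin (t * b) <= k ^+ 2 * (sin a * sin b).
  apply: le_trans (_ : (k * sin a) * (k * sin b) <= _).
    by apply: ler_pM.
  by rewrite le_eqVlt; apply/orP; left; apply/eqP; ring.
have ab2 : cos (t * (a - b)) = cos (t * `|a - b|).
  by rewrite -[LHS]cos_norm normrM (ger0_norm t0).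
have h1 : 1 - cos (t * (a - b)) <= k ^+ 2 * (1 - cos (a - b)).
  rewrite ab2 -(cos_norm (a - b)).
  have /shrink/andP[? ?] : 0 <= `|a - b| / 2 <= m.
    by rewrite divr_ge0//= ler_pdivrMr//; lra.
  by apply: le_1Bcos; rewrite -mulrA.
have h2 : 0 <= cos (a - b) - cos c.
  by rewrite subr_ge0 -(cos_norm (a - b)); apply: le_cos => //; lra.
(* Concavity of [sin] at [c / 2], squared. *)
have h3 : k ^+ 2 * (1 - cos c) <= 1 - cos (k * c).
  rewrite (cos_half c) (cos_half (k * c)).
  have sc : 0 <= sin (c / 2) by apply: sin_ge0_pi; lra.
  have kc : k * sin (c / 2) <= sin (k * c / 2).
    by rewrite -mulrA; apply: sin_mul_ge; [lra|rewrite k0].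
  have : (k * sin (c / 2)) ^+ 2 <= sin (k * c / 2) ^+ 2.
    by rewrite ler_pXn2r// nnegrE ?mulr_ge0// (le_trans _ kc)// mulr_ge0.
  rewrite exprMn; lra.
have sab : 0 < sin a * sin b by rewrite mulr_gt0.
(* Split [1 - cos c] as [(1 - cos (a - b)) + (cos (a - b) - cos c)], a radial and an angular part,
   both nonnegative. Moving towards the vertex shrinks the first by [k ^+ 2] according to [h1], and
   the second according to [stab]. *)
have key : sin a * sin b * (1 - D) <= sin a * sin b * (k ^+ 2 * (1 - cos c)).
  have -> : sin a * sin b * (1 - D) = sin a * sin b * (1 - cos (t * (a - b))) +
      sin (t * a) * sin (t * b) * (cos (a - b) - cos c).
    by rewrite [in LHS]mulrBr eqD (mulrBr t) !cosB -/t; ring.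
  have -> : sin a * sin b * (k ^+ 2 * (1 - cos c)) =
      sin a * sin b * (k ^+ 2 * (1 - cos (a - b))) +
      k ^+ 2 * (sin a * sin b) * (cos (a - b) - cos c) by ring.
  by rewrite lerD ?ler_wpM2l ?ler_wpM2r// ltW.
have : 1 - D <= 1 - cos (k * c).
  by apply: le_trans h3; rewrite -(ler_pM2l sab).
lra.
Qed.

Lemma acos_le x y : -1 <= x <= 1 -> 0 <= y <= pi -> cos y <= x -> acos x <= y.
Proof.
move=> xP /andP[y0 ypi] yx; have [] := acos_def xP.
move=> /andP[a0 api] eqx; rewrite leNgt; apply/negP => ya.
move: yx; rewrite -eqx leNgt ltr_cos ?in_itv/= ?y0 ?a0 ?ypi ?api//.
by rewrite ya.
Qed.

End Trigonometry.

(** * Geodesics and comparison triangles on the sphere *)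

Section Sphere.
Context {R : realType}.
Implicit Types (u v w : 'rV[R]_3) (p q r : sphere2 R) (a b c s t x : R).

Lemma dotpC u v : dotp u v = dotp v u.
Proof. by apply: eq_bigr => i _; rewrite mulrC. Qed.

Lemma dotpDl u v w : dotp (u + v) w = dotp u w + dotp v w.
Proof.
by rewrite /dotp -big_split/=; apply: eq_bigr => i _; rewrite mxE mulrDl.
Qed.

Lemma dotpZl x u v : dotp (x *: u) v = x * dotp u v.
Proof. by rewrite /dotp mulr_sumr; apply: eq_bigr => i _; rewrite mxE mulrA. Qed.

Lemma dotpDr u v w : dotp u (v + w) = dotp u v + dotp u w.
Proof. by rewrite !(dotpC u) dotpDl. Qed.

Lemma dotpZr x u v : dotp u (x *: v) = x * dotp u v.
Proof. by rewrite !(dotpC u) dotpZl. Qed.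

Definition dotpE := (dotpDl, dotpDr, dotpZl, dotpZr).

Lemma dotp_ge0 u : 0 <= dotp u u.
Proof. by apply: sumr_ge0 => i _; rewrite -expr2 sqr_ge0. Qed.

Lemma dotp_sphere p : dotp (val p) (val p) = 1.
Proof. exact/eqP/(valP p). Qed.

(** Cauchy-Schwarz for unit vectors: the squared norms of [p + q] and [p - q] are nonnegative. *)
Lemma dotp_sphere_itv p q : -1 <= dotp (val p) (val q) <= 1.
Proof.
have := dotp_ge0 (val p + 1 *: val q); have := dotp_ge0 (val p + (-1) *: val q).
by rewrite !dotpE !dotp_sphere (dotpC (val q)); lra.
Qed.

(* Meant for [dotp p q = cos a] with [sin a != 0], when the vector is a unit
   vector and the default value [p] of [insubd] is not used. *)
Definition slerp p q a s : sphere2 R :=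
  insubd p ((sin (a - s) / sin a) *: val p + (sin s / sin a) *: val q).

Section Slerp.
Variables (p q : sphere2 R) (a : R).
Hypotheses (sin_a : sin a != 0) (pq : dotp (val p) (val q) = cos a).

(** The case [s = t] shows that the combination is a unit vector, so that [insubd] keeps it; the
    general case says that the arc is parametrised by its angle. *)
Let slerp_dotp s t :
  dotp ((sin (a - s) / sin a) *: val p + (sin s / sin a) *: val q)
       ((sin (a - t) / sin a) *: val p + (sin t / sin a) *: val q) = cos (s - t).
Proof.
rewrite !dotpE !dotp_sphere (dotpC (val q)) pq.
rewrite !sinB cosB.
have sa2 : sin a ^+ 2 != 0 by rewrite expf_neq0.
apply: (mulfI sa2).
have -> : sin a ^+ 2 * (cos s * cos t + sin s * sin t) =
   sin a ^+ 2 * cos s * cos t + (1 - cos a ^+ 2) * (sin s * sin t).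
  by rewrite sin2cos2; ring.
by field.
Qed.

Lemma val_slerp s :
  val (slerp p q a s) = (sin (a - s) / sin a) *: val p + (sin s / sin a) *: val q.
Proof. by rewrite insubdK// unfold_in slerp_dotp subrr cos0. Qed.

Lemma dotp_slerp s t :
  dotp (val (slerp p q a s)) (val (slerp p q a t)) = cos (s - t).
Proof. by rewrite !val_slerp slerp_dotp. Qed.

Lemma slerp0 : slerp p q a 0 = p.
Proof.
by apply: val_inj; rewrite val_slerp subr0 divff// sin0 mul0r scale1r scale0r addr0.
Qed.

Lemma slerp_end : slerp p q a a = q.
Proof.
by apply: val_inj; rewrite val_slerp subrr divff// sin0 mul0r scale1r scale0r add0r.
Qed.

End Slerp.

(** Serves to measure from [u] a point of the comparison side that ends at [u]. *)
Lemma slerp_sym p q a s : sin a != 0 -> dotp (val p) (val q) = cos a ->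
  slerp p q a s = slerp q p a (a - s).
Proof.
move=> sa pq; apply: val_inj; rewrite !val_slerp// 1?dotpC//.
by rewrite subKr addrC.
Qed.

(** The squared norm of [p - q] is [2 - 2 * dotp p q = 0]. *)
Lemma dotp1_eq p q : dotp (val p) (val q) = 1 -> p = q.
Proof.
move=> pq; apply/val_inj/rowP => i.
have : dotp (val p + (-1) *: val q) (val p + (-1) *: val q) = 0.
  by rewrite !dotpE !dotp_sphere (dotpC (val q)) pq; ring.
move/eqP; rewrite psumr_eq0 => [|j _]; last by rewrite -expr2 sqr_ge0.
move/allP/(_ i (mem_index_enum _)); rewrite /= mulf_eq0 orbb !mxE mulN1r subr_eq0.
by move/eqP.
Qed.

Section ModelGeodesics.
Variables (kappa : R) (kappa_gt0 : 0 < kappa).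
Let rk := Num.sqrt kappa.
Let rk_gt0 : 0 < rk. Proof. by rewrite sqrtr_gt0. Qed.

Lemma model_dist_cos p q d : 0 <= d -> rk * d <= pi ->
  dotp (val p) (val q) = cos (rk * d) -> model_dist kappa p q = d.
Proof.
move=> d0 dpi pq; rewrite /model_dist pq cosK ?in_itv/= ?mulr_ge0 ?(ltW rk_gt0)//.
by rewrite mulrAC divff ?mul1r// gt_eqF.
Qed.

(** The factor [rk] turns lengths in the model space into angles. At [d = 0] the quotients in
    [slerp] degenerate, and the constant path is the geodesic. *)
Definition model_path p q d s := if d == 0 then p else slerp p q (rk * d) (rk * s).

Lemma model_geodesic_path p q d : 0 <= d -> rk * d < pi ->
  dotp (val p) (val q) = cos (rk * d) ->
  geodesic_path (model_dist kappa) p q d (model_path p q d).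
Proof.
move=> d0 dpi pq; rewrite /model_path; split => //.
- by case: eqP => // /eqP dn0; rewrite mulr0 slerp0//
    gt_eqF// sin_gt0_pi// dpi mulr_gt0// lt_neqAle eq_sym dn0.
- case: eqP => [d00|/eqP dn0].
    by apply: dotp1_eq; rewrite pq d00 mulr0 cos0.
  by rewrite slerp_end// gt_eqF// sin_gt0_pi// dpi mulr_gt0// lt_neqAle eq_sym dn0.
move=> s t /andP[s0 sd] /andP[t0 td]; case: eqP => [d00|/eqP dn0].
  have -> : s = 0 by lra.
  have -> : t = 0 by lra.
  by rewrite subrr normr0 /model_dist dotp_sphere acos1 mul0r.
have sa : sin (rk * d) != 0.
  by rewrite gt_eqF// sin_gt0_pi// dpi mulr_gt0// lt_neqAle eq_sym dn0.
have std : `|s - t| <= d by rewrite ler_norml; lra.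
apply: model_dist_cos => //.
  by apply: le_trans (ltW dpi); rewrite ler_pM2l.
by rewrite dotp_slerp// -mulrBr -[LHS]cos_norm normrM (gtr0_norm rk_gt0).
Qed.

End ModelGeodesics.

(** Put [p] at the first basis vector, [q] in the plane of the first two at angle [a], and [r] at
    angle [b] from [p]. The law of cosines forces the cosine [y] of the angle at [p]; the triangle
    inequalities and [a + b <= pi] give [cos (a + b) <= cos c <= cos (a - b)], which is
    [|y| <= 1]. *)
Lemma comparison_triangle_exists a b c : 0 < a < pi -> 0 < b < pi -> 0 <= c ->
  `|a - b| <= c -> c <= a + b -> a + b <= pi ->
  exists p q r, [/\ dotp (val p) (val q) = cos a, dotp (val p) (val r) = cos b
                 & dotp (val q) (val r) = cos c].
Proof.
move=> /andP[a0 api] /andP[b0 bpi] c0 abc cab abpi.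
have sa : 0 < sin a by apply: sin_gt0_pi; rewrite a0.
have sb : 0 < sin b by apply: sin_gt0_pi; rewrite b0.
pose y := (cos c - cos a * cos b) / (sin a * sin b).
have ey : sin a * sin b * y = cos c - cos a * cos b.
  by rewrite mulrC divfK// mulf_neq0// gt_eqF.
have h1 : cos c <= cos (a - b).
  by rewrite -(cos_norm (a - b)); apply: le_cos => //; lra.
have h2 : cos (a + b) <= cos c by apply: le_cos.
have y1 : y ^+ 2 <= 1.
  rewrite -real_normK ?num_real// expr_le1// ler_norml.
  rewrite ler_pdivlMr ?mulr_gt0// ler_pdivrMr ?mulr_gt0//.
  move: h1 h2; rewrite cosB cosD; lra.
pose vec (x1 x2 x3 : R) : 'rV[R]_3 := \row_(i < 3) [:: x1; x2; x3]`_i.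
have vecE x1 x2 x3 z1 z2 z3 :
    dotp (vec x1 x2 x3) (vec z1 z2 z3) = x1 * z1 + x2 * z2 + x3 * z3.
  by rewrite /dotp !big_ord_recr big_ord0/= !mxE/= add0r.
have sqr : Num.sqrt (1 - y ^+ 2) ^+ 2 = 1 - y ^+ 2 by rewrite sqr_sqrtr// subr_ge0.
have P1 : dotp (vec 1 0 0) (vec 1 0 0) == 1 by rewrite vecE; apply/eqP; ring.
have P2 : dotp (vec (cos a) (sin a) 0) (vec (cos a) (sin a) 0) == 1.
  by rewrite vecE -[X in _ == X](cos2Dsin2 a); apply/eqP; ring.
pose w := vec (cos b) (sin b * y) (sin b * Num.sqrt (1 - y ^+ 2)).
have P3 : dotp w w == 1.
  rewrite vecE -[X in _ == X](cos2Dsin2 b); apply/eqP.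
  transitivity (cos b ^+ 2 + sin b ^+ 2 * (y ^+ 2 + Num.sqrt (1 - y ^+ 2) ^+ 2)).
    ring.
  by rewrite sqr; ring.
pose point v : dotp v v == 1 -> sphere2 R := exist (fun v => dotp v v == 1) v.
exists (point _ P1), (point _ P2), (point _ P3); split => /=.
- by rewrite vecE; ring.
- by rewrite vecE; ring.
rewrite vecE mul0r addr0 mulrA ey; ring.
Qed.

End Sphere.

(** The law of cosines in the triangle cut off at [p], whose angle there is expressed by [a], [b],
    [c]; this is the equation on [D] in [spherical_contraction]. *)
Lemma sin_mul_dotp_slerp {R : realType} (p q r : sphere2 R) (a b c s t : R) :
  sin a != 0 -> sin b != 0 ->
  dotp (val p) (val q) = cos a -> dotp (val p) (val r) = cos b ->
  dotp (val q) (val r) = cos c ->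
  sin a * sin b * dotp (val (slerp p q a s)) (val (slerp p r b t)) =
  sin a * sin b * (cos s * cos t) + sin s * sin t * (cos c - cos a * cos b).
Proof.
move=> sa sb pq pr qr; rewrite !val_slerp// !dotpE dotp_sphere (dotpC (val q)) pq pr qr.
by rewrite !sinB; field; rewrite sa sb.
Qed.

(** * Length and reversal of geodesics *)

Section GeodesicSegments.
Context {R : realType} {T : Type} (dist : T -> T -> R).
Implicit Types (x y z : T) (S : set T).

Lemma geodesic_path_length x y l c : geodesic_path dist x y l c -> dist x y = l.
Proof.
by case=> l0 <- <- cE; rewrite cE ?lexx ?l0// sub0r normrN ger0_norm.
Qed.

Lemma geodesic_segment_rev x y S :
  geodesic_segment dist x y S -> geodesic_segment dist y x S.
Proof.
move=> [l [c [[l0 c0 cl cE] ->]]]; exists l, (fun s => c (l - s)); split.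
  split; rewrite ?subr0 ?subrr// => s t sl tl; rewrite cE; [|lra..].
  by rewrite (_ : l - s - (l - t) = - (s - t)) ?normrN//; ring.
by apply/seteqP; split => z [s /=]; rewrite in_itv/= => sl <-;
  exists (l - s); rewrite /= ?in_itv/= ?subKr//; lra.
Qed.

End GeodesicSegments.

(** * Contraction towards a point of a CAT space *)

Section Contraction.
Context {R : realType}.
Variables (kappa : R) (kappa_gt0 : 0 < kappa) (X : metricType R).
Hypothesis X_CAT : CAT kappa X.
Let rk := Num.sqrt kappa.
Let rk_gt0 : 0 < rk. Proof. by rewrite sqrtr_gt0. Qed.

Lemma CAT_contraction (M l : R) (u y y' z z' : X) : M * rk < pi / 2 ->
  0 <= l <= 1 -> mdist u y <= M -> mdist u y' <= M -> mdist y y' <= M ->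
  geodesic_combination mdist (1 - l) u y z ->
  geodesic_combination mdist (1 - l) u y' z' ->
  mdist z z' <= (1 - l * cos (M * rk)) * mdist y y'.
Proof.
move=> Mpi lP dyM dy'M dyy'M [S [Sg Sz zu zy]] [S' [Sg' Sz' zu' zy']].
have /andP[l0 l1] := lP; have pi0 := @pi_gt0 R.
have M0 : 0 <= M := le_trans (mdist_ge0 _ _) dyM.
have m0 : 0 <= M * rk by rewrite mulr_ge0// ltW.
have cosm1 := cos_le1 (M * rk).
have cosm0 : 0 <= cos (M * rk) by apply: cos_ge0_pihalf; lra.
have lcos : l * cos (M * rk) <= l by rewrite ler_piMr.
have lcos0 : 0 <= l * cos (M * rk) by rewrite mulr_ge0.
have dyy'0 := mdist_ge0 y y'.
have tk w : (1 - l) * mdist u w <= (1 - l * cos (M * rk)) * mdist u w.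
  by rewrite ler_wpM2r// ?mdist_ge0//; lra.
(* Degenerate triangles, where [sin a] or [sin b] vanishes, come first: one of [z], [z'] is [u], and
   [tk] bounds the distance to the other. *)
have [uy|uy] := eqVneq u y.
  have zz : u = z.
    by apply/esym/mdist_positivity; rewrite zu uy mdistxx mulr0.
  by rewrite -zz -uy metric_sym zu'.
have [uy'|uy'] := eqVneq u y'.
  have zz : u = z'.
    by apply/esym/mdist_positivity; rewrite zu' uy' mdistxx mulr0.
  by rewrite -zz -uy' (metric_sym y) zu.
pose a := rk * mdist u y; pose b := rk * mdist u y'; pose c := rk * mdist y y'.
have a0 : 0 < a by rewrite mulr_gt0// mdist_gt0.
have b0 : 0 < b by rewrite mulr_gt0// mdist_gt0.
have c0 : 0 <= c by rewrite mulr_ge0// ltW.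
have am : a <= M * rk by rewrite [leRHS]mulrC ler_pM2l.
have bm : b <= M * rk by rewrite [leRHS]mulrC ler_pM2l.
have cm : c <= M * rk by rewrite [leRHS]mulrC ler_pM2l.
have abc : `|a - b| <= c.
  rewrite -mulrBr normrM (gtr0_norm rk_gt0) ler_pM2l// ler_norml.
  have := metric_triangle u y' y; have := metric_triangle u y y'.
  by rewrite (metric_sym y' y); lra.
have cab : c <= a + b.
  by rewrite -mulrDr ler_pM2l// (metric_sym u y) metric_triangle.
have [p [q [r [pq pr qr]]]] : exists p q r : sphere2 R,
    [/\ dotp (val p) (val q) = cos a, dotp (val p) (val r) = cos b
      & dotp (val q) (val r) = cos c].
  by apply: comparison_triangle_exists => //; lra.
have rp : dotp (val r) (val p) = cos b by rewrite dotpC.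
have sa : sin a != 0 by rewrite gt_eqF// sin_gt0_pi//; lra.
have sb : sin b != 0 by rewrite gt_eqF// sin_gt0_pi//; lra.
have MD : M < model_diam kappa.
  by rewrite /model_diam ltr_pdivlMr//; apply: lt_trans Mpi _; lra.
have [S1 Sg1] := X_CAT.1 _ _ (le_lt_trans dyy'M MD).
(* Side 2 runs from [y'] to [u], so comparison points there are measured
   from [y']. *)
pose v (i : 'I_3) := nth u [:: u; y; y'] i.
pose side (i : 'I_3) := nth set0 [:: S; S1; S'] i.
pose w (i : 'I_3) := nth p [:: p; q; r] i.
pose arc (p q : sphere2 R) d := model_path kappa p q d @` `[0, d].
pose wside (i : 'I_3) :=
  nth set0 [:: arc p q (mdist u y); arc q r (mdist y y'); arc r p (mdist u y')] i.
have gpq : geodesic_path (model_dist kappa) p q (mdist u y)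
    (model_path kappa p q (mdist u y)).
  by apply: model_geodesic_path; rewrite ?mdist_ge0//; apply: le_lt_trans am _; lra.
have gqr : geodesic_path (model_dist kappa) q r (mdist y y')
    (model_path kappa q r (mdist y y')).
  by apply: model_geodesic_path; rewrite ?mdist_ge0//; apply: le_lt_trans cm _; lra.
have grp : geodesic_path (model_dist kappa) r p (mdist u y')
    (model_path kappa r p (mdist u y')).
  by apply: model_geodesic_path; rewrite ?mdist_ge0//; apply: le_lt_trans bm _; lra.
have tri : geodesic_triangle mdist v side.
  case=> -[|[|[|//]]] i3; [exact: Sg|exact: Sg1|exact: (geodesic_segment_rev Sg')].
(* The perimeter is at most [3 * M], and [M] is below half of [model_diam kappa]. *)
have per : perimeter mdist v < 2 * model_diam kappa.
  rewrite /perimeter !big_ord_recr big_ord0/= add0r.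
  rewrite -[X in X < _]/(mdist u y + mdist y y' + mdist y' u) (metric_sym y').
  have : M < model_diam kappa / 2 by rewrite /model_diam mulrAC ltr_pdivlMr.
  lra.
have cmp : comparison_triangle kappa v w wside.
  split.
    case=> -[|[|[|//]]] i3; do 2!eexists; split;
      [exact: gpq|by []|exact: gqr|by []|exact: grp|by []].
  case=> -[|[|[|//]]] i3.
  - exact: (geodesic_path_length gpq).
  - exact: (geodesic_path_length gqr).
  - by rewrite [RHS](metric_sym y' u); exact: (geodesic_path_length grp).
pose sz := (1 - l) * mdist u y; pose sz' := l * mdist u y'.
have szP : 0 <= sz <= mdist u y.
  by rewrite mulr_ge0 ?ler_piMl ?mdist_ge0//=; lra.
have szP' : 0 <= sz' <= mdist u y' by rewrite mulr_ge0 ?ler_piMl ?mdist_ge0.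
pose pz := model_path kappa p q (mdist u y) sz.
pose pz' := model_path kappa r p (mdist u y') sz'.
have cz : comparison_point kappa v w wside ord0 z pz.
  split; first by exists sz; rewrite /= ?in_itv.
  have [_ c00 _ /(_ 0 sz)] := gpq; rewrite c00 => -> //; last by rewrite lexx mdist_ge0.
  by rewrite sub0r normrN ger0_norm ?(andP szP).1// [RHS]metric_sym.
have cz' : comparison_point kappa v w wside ord_max z' pz'.
  split; first by exists sz'; rewrite /= ?in_itv.
  have [_ c00 _ /(_ 0 sz')] := grp; rewrite c00 => -> //; last by rewrite lexx mdist_ge0.
  rewrite sub0r normrN ger0_norm ?(andP szP').1// [RHS]metric_sym zy' /sz'; ring.
apply: le_trans (X_CAT.2 _ _ tri per _ _ cmp ord0 ord_max _ _ _ _ Sz Sz' cz cz') _.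
(* Passing from lengths to angles leaves an upper bound on an [acos]. *)
rewrite ler_pdivrMr// -mulrA [mdist y y' * _]mulrC -/c.
have kc : (1 - l * cos (M * rk)) * c <= c by rewrite ler_piMl//; lra.
apply: acos_le; first exact: dotp_sphere_itv.
  by rewrite mulr_ge0//=; lra.
apply: (spherical_contraction (a := a) (b := b)) => //; [exact: ltW|lra|lra|].
have -> : pz = slerp p q a ((1 - l) * a).
  by rewrite /pz /model_path ifN ?gt_eqF ?mdist_gt0//; congr slerp; rewrite /a /sz /rk; ring.
have -> : pz' = slerp p r b ((1 - l) * b).
  rewrite /pz' /model_path ifN ?gt_eqF ?mdist_gt0// slerp_sym//.
  by congr slerp; rewrite /b /sz' /rk; ring.
exact: sin_mul_dotp_slerp.
Qed.

End Contraction.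

(** * Quantitative analysis of the real recurrence *)

Section Recurrence.
Context {R : realType}.

(** Induction on [n]: the new factor [1 - mu] is at most [expR (- mu)] on the first term, and at
    most 1 on the accumulated errors. *)
Lemma contraction_recurrence (a b mu : nat -> R) (G n : nat) :
  (forall i, 0 <= a i) -> (forall i, 0 <= b i) -> (forall i, 0 <= mu i <= 1) ->
  (forall i, a i.+1 <= (1 - mu i.+1) * a i + b i.+1) ->
  a (G + n)%N <= expR (- \sum_(G + 1 <= i < (G + n).+1) mu i) * a G
                 + \sum_(G + 1 <= i < (G + n).+1) b i.
Proof.
move=> a0 b0 mu01 rec; elim: n => [|n IH].
  by rewrite addn0 addn1 !big_geq// oppr0 expR0 mul1r addr0.
have Gn : (G + 1 <= (G + n).+1)%N by rewrite addn1 ltnS leq_addr.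
rewrite addnS !(big_nat_recr (G + n).+1)//= opprD expRD.
set E := expR _ in IH *; set B := \sum_(_ <= _ < _) b _ in IH *.
have /andP[mu0 mu1] := mu01 (G + n).+1.
have B0 : 0 <= B by apply: sumr_ge0.
have E0 : 0 <= E * a G by rewrite mulr_ge0// expR_ge0.
have mu1' : 0 <= 1 - mu (G + n).+1 by rewrite subr_ge0.
apply: le_trans (rec _) _; rewrite addrA lerD2r.
apply: le_trans (ler_wpM2l mu1' IH) _.
rewrite mulrDr lerD//; last by rewrite ler_piMl// gerBl.
by rewrite [leRHS]mulrAC [leRHS]mulrC ler_wpM2r// expR_ge1Dx.
Qed.

Lemma rate_of_convergence_cvg (Phi : R -> nat) (a : nat -> R) :
  (forall n, 0 <= a n) -> rate_of_convergence Phi a -> a @ \oo --> (0 : R).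
Proof.
move=> a0 rate; apply/cvgr0Pnorm_le => e e0.
exists (Phi e) => // n /= Phin; rewrite ger0_norm//.
exact: (rate e e0).2.
Qed.

Lemma Phi_tilde_rate (kappa M : R) (lam a : nat -> R) (alpha gamma : R -> nat)
    (theta : nat -> nat) :
  0 < M -> 0 < cos (M * Num.sqrt kappa) ->
  (forall n, (1 <= n)%N -> 0 <= lam n <= 1) ->
  condition_star lam alpha gamma theta ->
  (forall n, 0 <= a n <= M) ->
  (forall n, a n.+1 <= (1 - lam n.+2 * cos (M * Num.sqrt kappa)) * a n
                       + M * `|lam n.+2 - lam n.+1|) ->
  rate_of_convergence (fun eps => Phi_tilde eps kappa M gamma theta) a.
Proof.
move=> M0; rewrite /Phi_tilde; set c := cos _ => c0 lam01 star aM rec eps eps0.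
set K := `|_|%N; set G := gamma _; set L := `|Num.max _ _|%N.
have e0 : 0 < eps / (2 * M) by rewrite divr_gt0// mulr_gt0.
have c1 : c <= 1 by exact: cos_le1.
(* [K] is the ceiling of [1 / c]: it compensates the factor [c] in the exponent. *)
have KE : 1 <= K%:R * c.
  rewrite -ler_pdivrMr//; apply: le_trans (ceil_ge _) _.
  rewrite -[K%:R]/(K%:Z%:~R) ler_int /K abszE; exact: ler_norm.
have K0 : (0 < K)%N.
  by rewrite -(ltr0n R) -(pmulr_lgt0 _ c0) (lt_le_trans ltr01).
have LZ : (L%:Z : int) = Num.max (Num.ceil (ln (2 * M / eps))) 1.
  by rewrite /L gez0_abs// le_max ler01 orbT.
have L0 : (0 < L)%N.
  by rewrite -ltz_nat LZ lt_max ltr01 orbT.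
have LE : ln (2 * M / eps) <= L%:R.
  apply: le_trans (ceil_ge _) _.
  by rewrite -[L%:R]/(L%:Z%:~R) ler_int LZ le_max lexx.
have KGL0 : (0 < K * (G + L))%N by rewrite muln_gt0 K0 addn_gt0 L0 orbT.
split=> [|n]; first exact: (theta_pos star).
set N := theta _ => Nn.
have lamS k : 0 <= lam k.+1 <= 1 by exact: lam01.
have sum_le m1 m2 : \sum_(m1 <= k < m2) lam k.+1 <= (m2 - m1)%:R.
  apply: le_trans (_ : \sum_(m1 <= k < m2) 1 <= _).
    by apply: ler_sum => k _; case/andP: (lamS k).
  by rewrite sumr_const_nat.
have sum_ge0 m1 m2 : 0 <= \sum_(m1 <= k < m2) lam k.+1.
  by apply: sumr_ge0 => k _; case/andP: (lamS k).
have SN := star3 star KGL0; rewrite -/N in SN.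
(* Each summand is at most 1, so a sum of [N] of them reaching [K * (G + L)] has at least that many
   terms. *)
have KN : (K * (G + L) <= N)%N.
  by rewrite -(ler_nat R); apply: le_trans SN _; apply: le_trans (sum_le _ _) _;
    rewrite subn1.
have GK : (G <= K * G)%N by rewrite leq_pmull.
have LK : (0 < K * L)%N by rewrite muln_gt0 K0.
(* The maximum with 1 in [L] gives strictness, and [star2] is stated for ranges of positive
   length. *)
have Gn : (G < n)%N.
  by apply: leq_trans Nn; apply: leq_trans KN; rewrite mulnDr -[G.+1]addn1 leq_add.
(* The first [G] terms contribute at most [G <= K * G], which leaves [K * L] for the rest. *)
have Sn : (K * L)%:R <= \sum_(G + 1 <= k < n.+1) lam k.+1.
  have SNn : (K * (G + L))%:R <= \sum_(1 <= k < n.+1) lam k.+1.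
    apply: le_trans SN _.
    by rewrite [leRHS](big_cat_nat (n := N.+1))// lerDl.
  move: SNn; rewrite (big_cat_nat (n := (G + 1)%N)) ?addn1//; last by rewrite ltnS ltnW.
  have := sum_le 1%N G.+1; rewrite subn1 /= mulnDr natrD.
  have : G%:R <= (K * G)%:R :> R by rewrite ler_nat.
  lra.
have nE : (G + (n - G))%N = n by rewrite subnKC// ltnW.
have mu01 i : 0 <= c * lam i.+1 <= 1.
  by have /andP[x0 x1] := lamS i; rewrite mulr_ge0 ?(ltW c0)//= mulr_ile1// ltW.
(* With the index of [lam] shifted by one, the summands are those of [star2] and [star3]. *)
have := @contraction_recurrence a (fun i => M * `|lam i.+1 - lam i|)
  (fun i => c * lam i.+1) G (n - G).
rewrite nE -!mulr_sumr => H.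
apply: le_trans (H _ _ mu01 _) _.
- by move=> i; case/andP: (aM i).
- by move=> i; rewrite mulr_ge0// ltW.
- by move=> i; rewrite (mulrC c); exact: rec.
have h2 : \sum_(G + 1 <= i < n.+1) `|lam i.+1 - lam i| <= eps / (2 * M).
  by have := star2 star e0; move/(_ (n - G)%N); rewrite -/G nE subn_gt0; apply.
(* [eps / (2 * M)] is [expR (- ln (2 * M / eps))], and [c * (K * L) >= L] dominates that
   logarithm. *)
have h1 : expR (- (c * \sum_(G + 1 <= i < n.+1) lam i.+1)) <= eps / (2 * M).
  rewrite -[leRHS]invrK invf_div -[X in X^-1]lnK ?posrE ?divr_gt0 ?mulr_gt0//.
  rewrite -expRN ler_expR lerN2; apply: le_trans LE _.
  apply: le_trans (_ : c * (K * L)%:R <= _); last by rewrite ler_pM2l.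
  by rewrite natrM mulrA (mulrC c) ler_peMl.
have /andP[aG0 aGM] := aM G.
have -> : eps = eps / (2 * M) * M + M * (eps / (2 * M)) by field; rewrite gt_eqF.
by rewrite lerD// ?ler_pM2l// ler_pM// expR_ge0.
Qed.

End Recurrence.

(** * Rates of asymptotic regularity for the Halpern iteration *)

Theorem proposition3p2 (R : realType) (kappa : R) (hkappa : 0 < kappa)
  (X : metricType R) (hX : CAT kappa X)
  (C : set X) (hCbounded : (diameter mdist C < +oo)%E) (hCconvex : convex mdist C)
  (T : X -> X) (hTC : set_fun C C T) (hT : nonexpansive_on mdist C T)
  (M : R) (hM : 0 < M < model_diam kappa / 2) (hCM : (diameter mdist C <= M%:E)%E)
  (lam : nat -> R) (hlam : forall n, (1 <= n)%N -> 0 <= lam n <= 1)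
  (alpha gamma : R -> nat) (theta : nat -> nat)
  (hstar : condition_star lam alpha gamma theta)
  (u : X) (hu : C u) (x : nat -> X) (hx0 : x 0%N = u)
  (hx : forall n,
     geodesic_combination mdist (1 - lam n.+1) u (T (x n)) (x n.+1)) :
  [/\ (fun n => mdist (x n) (x n.+1)) @ \oo --> (0 : R),
      rate_of_convergence (fun eps => Phi_tilde eps kappa M gamma theta)
        (fun n => mdist (x n) (x n.+1)),
      (fun n => mdist (x n) (T (x n))) @ \oo --> (0 : R) &
      rate_of_convergence (fun eps => Phi_rate eps kappa M gamma theta alpha)
        (fun n => mdist (x n) (T (x n)))].
Proof.
have [M0 Mdiam] := andP hM; have k0 : 0 < Num.sqrt kappa by rewrite sqrtr_gt0.
have Mpi : M * Num.sqrt kappa < pi / 2.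
  by move: Mdiam; rewrite /model_diam mulrAC ltr_pdivlMr.
have c0 : 0 < cos (M * Num.sqrt kappa).
  by apply: cos_gt0_pihalf; rewrite Mpi andbT; apply: lt_trans (mulr_gt0 M0 k0);
    rewrite oppr_lt0 divr_gt0 ?pi_gt0.
have lamS n : 0 <= lam n.+1 <= 1 by exact: hlam.
have diamM y z : C y -> C z -> mdist y z <= M.
  move=> Cy Cz; rewrite -lee_fin; apply: le_trans hCM.
  by apply: ereal_sup_ubound; exists (y, z).
have xC n : C (x n).
  elim: n => [|n IH]; first by rewrite hx0.
  have [S [Sg Sx _ _]] := hx n; apply: hCconvex Sg _ Sx => //; exact: hTC.
have TC n : C (T (x n)) by exact: hTC.
have step n : mdist (x n.+1) (x n.+2) <=
    (1 - lam n.+2 * cos (M * Num.sqrt kappa)) * mdist (x n) (x n.+1)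
    + M * `|lam n.+2 - lam n.+1|.
  have [S [Sg Sx xu xT]] := hx n; have [l [c [P SE]]] := Sg.
  have dE := geodesic_path_length P; have [l0 c0' cl cE] := P.
  have /andP[l1 l2] := lamS n; have /andP[l3 l4] := lamS n.+1.
  have point s : 0 <= s <= 1 -> 0 <= (1 - s) * l <= l.
    by move=> /andP[s0 s1]; rewrite mulr_ge0 ?ler_piMl//; lra.
  have xE : exists2 s, 0 <= s <= l & c s = x n.+1.
    by move: Sx; rewrite SE => -[s]; rewrite /= in_itv/=; exists s.
  have [s sl sx] := xE.
  have sE : s = (1 - lam n.+1) * l.
    rewrite -dE -xu -sx metric_sym -c0' cE ?lexx ?l0//.
    by rewrite sub0r normrN ger0_norm//; case/andP: sl.
  (* [w] lies on the geodesic from [u] to [T (x n)] that carries [x n.+1], but uses the next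
     coefficient. It differs from [x n.+1] only in the coefficient, and from [x n.+2] only in the
     far endpoint, where [CAT_contraction] applies. *)
  pose w := c ((1 - lam n.+2) * l).
  have wcomb : geodesic_combination mdist (1 - lam n.+2) u (T (x n)) w.
    exists S; split=> //.
    - by rewrite SE; exists ((1 - lam n.+2) * l); rewrite //= in_itv/= point.
    - rewrite /w dE -c0' cE ?lexx ?l0 ?point// subr0 ger0_norm//.
      by case/andP: (point _ (lamS n.+1)).
    - rewrite /w dE -cl cE ?lexx ?l0 ?point// distrC ger0_norm; first by ring.
      by rewrite subr_ge0; case/andP: (point _ (lamS n.+1)).
  have xw : mdist (x n.+1) w <= M * `|lam n.+2 - lam n.+1|.
    rewrite -sx sE cE ?point// (_ : _ - _ = l * (lam n.+2 - lam n.+1)); last by ring.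
    by rewrite normrM ger0_norm// ler_wpM2r// -dE diamM.
  have wx := CAT_contraction hkappa hX Mpi (lamS n.+1) (diamM _ _ hu (TC n))
    (diamM _ _ hu (TC n.+1)) (diamM _ _ (TC n) (TC n.+1)) wcomb (hx n.+1).
  apply: le_trans (metric_triangle _ w _) _; rewrite addrC lerD//.
  apply: le_trans wx _; apply: ler_wpM2l; last exact: hT.
  by rewrite subr_ge0 mulr_ile1// ?(ltW c0)// cos_le1.
have rate : rate_of_convergence (fun eps => Phi_tilde eps kappa M gamma theta)
    (fun n => mdist (x n) (x n.+1)).
  by apply: Phi_tilde_rate hstar _ step => // n; rewrite mdist_ge0 diamM.
have rateT : rate_of_convergence (fun eps => Phi_rate eps kappa M gamma theta alpha)
    (fun n => mdist (x n) (T (x n))).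
  move=> eps eps0; have [P0 Pn] := rate _ (divr_gt0 eps0 (ltr0Sn R 1)).
  split=> [|n]; first by rewrite /Phi_rate leq_max P0.
  rewrite /Phi_rate geq_max => /andP[/Pn xn an].
  have e0 : 0 < eps / (2 * M) by rewrite divr_gt0// mulr_gt0.
  have lam_eps := star1 hstar e0 an.
  (* The second distance is [lam n.+1 * mdist u (T (x n))]; each of the two is at most [eps / 2]. *)
  apply: le_trans (metric_triangle _ (x n.+1) _) _.
  have [_ [_ _ _ ->]] := hx n; rewrite subKr.
  have : lam n.+1 * mdist u (T (x n)) <= eps / (2 * M) * M.
    by rewrite ler_pM ?mdist_ge0 ?diamM//; case/andP: (lamS n).
  have -> : eps / (2 * M) * M = eps / 2 by field; rewrite gt_eqF.
  lra.
by split => //; apply: rate_of_convergence_cvg; [|exact: rate| |exact: rateT] => n;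
  exact: mdist_ge0.
Qed.
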